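(* Let $m, n, r$ be nonnegative integers with $r < \min\{m, n\}$. Let $X \in \mathbb{R}_{\le r}^{m \times n}$ and let $\underline{r} := \operatorname{rank} X$. Then \begin{align*} T_{\mathbb{R}_{\le r}^{m \times n}}(X) &= T_{\mathbb{R}_{\underline{r}}^{m \times n}}(X) + \left(N_{\mathbb{R}_{\underline{r}}^{m \times n}}(X) \cap \mathbb{R}_{\le r-\underline{r}}^{m \times n}\right)\\ &= T_{\mathbb{R}_{\underline{r}}^{m \times n}}(X) + \mathbb{R}_{\le r-\underline{r}}^{m \times n}\\ &= \left\{Z \in \mathbb{R}^{m \times n} \mid \operatorname{rank} P_{N_{\mathbb{R}_{\underline{r}}^{m \times n}}(X)}(Z) \le r-\underline{r}\right\}, \end{align*} where sums of sets are Minkowski sums.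
   Context: For a nonnegative integer $k$, $\mathbb{R}_{\le k}^{m \times n} := \{Y \in \mathbb{R}^{m \times n} \mid \operatorname{rank} Y \le k\}$ and $\mathbb{R}_{k}^{m \times n} := \{Y \in \mathbb{R}^{m \times n} \mid \operatorname{rank} Y = k\}$. The space $\mathbb{R}^{m \times n}$ is endowed with the Frobenius inner product $\langle Y, W \rangle = \operatorname{tr}(W^\top Y)$. For a nonempty subset $S$ of a Euclidean vector space $\mathcal{E}$ and $x \in S$, the tangent cone $T_S(x)$ is the set of all $v \in \mathcal{E}$ for which there exist sequences $(x_i)_{i \in \mathbb{N}}$ in $S$ converging to $x$ and $(t_i)_{i \in \mathbb{N}}$ in $(0, \infty)$ such that $\left(\frac{x_i - x}{t_i}\right)_{i \in \mathbb{N}}$ converges to $v$. If $S$ is an embedded submanifold of $\mathcal{E}$ locally around $x$, then $T_S(x)$ is the usual tangent space (a linear subspace), and the normal space $N_S(x)$ is its orthogonal complement in $\mathcal{E}$. For each $k \in \{0, \dots, \min\{m,n\}\}$, $\mathbb{R}_k^{m \times n}$ is an embedded submanifold of $\mathbb{R}^{m \times n}$. For a linear subspace $L$ of $\mathcal{E}$, $P_L$ denotes the orthogonal projection onto $L$. *)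

(* Defs.v *)
From mathcomp Require Import all_boot all_order all_algebra.
From mathcomp Require Import all_classical all_reals all_analysis.

Set Implicit Arguments.
Unset Strict Implicit.
Unset Printing Implicit Defensive.

Import Order.TTheory GRing.Theory Num.Theory.
Import numFieldNormedType.Exports.

Local Open Scope classical_set_scope.
Local Open Scope ring_scope.

Definition tangent_cone (R : realType) (E : normedModType R) (S : set E) (x : E)
    : set E :=
  [set v | exists x_ : nat -> E, exists t_ : nat -> R,
     [/\ forall i, S (x_ i),
         x_ @ \oo --> x,
         forall i, 0 < t_ i
       & (fun i => (t_ i)^-1 *: (x_ i - x)) @ \oo --> v]].

Definition mx_rank_le (R : realType) (m n k : nat) : set 'M[R]_(m, n) :=
  [set Y | (\rank Y <= k)%N].

Definition mx_rank_eq (R : realType) (m n k : nat) : set 'M[R]_(m, n) :=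
  [set Y | \rank Y = k].

Arguments mx_rank_le R m n k : clear implicits.
Arguments mx_rank_eq R m n k : clear implicits.

(* The norm (hence topology) that the library puts on matrices is the entrywise
   max norm; it is equivalent to the norm induced by [frob], so convergence in
   [tangent_cone] is convergence in the Frobenius norm. *)
Definition frob (R : realType) (m n : nat) (Y W : 'M[R]_(m, n)) : R :=
  \tr (W^T *m Y).

Definition orth_compl (R : realType) (m n : nat) (L : set 'M[R]_(m, n))
    : set 'M[R]_(m, n) :=
  [set W | forall V, L V -> frob V W = 0].

(* At points around which [S] is an embedded submanifold, [tangent_cone S X] is
   the tangent space of [S]. *)
Definition mx_normal_space (R : realType) (m n : nat) (S : set 'M[R]_(m, n))
    (X : 'M[R]_(m, n)) : set 'M[R]_(m, n) :=
  orth_compl (tangent_cone S X).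

(* For a linear subspace [L], this is the unique [W] in [L] such that [Z - W] is
   orthogonal to [L]; see [orth_projE]. The default value 0 is only reached for
   sets [L] that are not linear subspaces. *)
Definition orth_proj (R : realType) (m n : nat) (L : set 'M[R]_(m, n))
    (Z : 'M[R]_(m, n)) : 'M[R]_(m, n) :=
  xget 0 [set W | L W /\ orth_compl L (Z - W)].

Lemma frob_eq0 (R : realType) (m n : nat) (A : 'M[R]_(m, n)) :
  frob A A = 0 -> A = 0.
Proof.
rewrite /frob /mxtrace => h.
have {}h : \sum_(j < n) \sum_(i < m) A i j ^+ 2 = 0.
  rewrite -[RHS]h; apply: eq_bigr => j _; rewrite mxE; apply: eq_bigr => i _.
  by rewrite mxE expr2.
apply/matrixP => i j; rewrite mxE.
have h1 : \sum_(i < m) A i j ^+ 2 = 0.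
  move: h => /psumr_eq0P; apply => // k _.
  by apply: sumr_ge0 => l _; exact: sqr_ge0.
have /eqP : A i j ^+ 2 = 0.
  by move: h1 => /psumr_eq0P; apply => // k _; exact: sqr_ge0.
by rewrite sqrf_eq0 => /eqP.
Qed.

Lemma orth_projE (R : realType) (m n : nat) (L : set 'M[R]_(m, n))
    (Z W : 'M[R]_(m, n)) :
  (forall U V, L U -> L V -> L (U - V)) ->
  L W -> orth_compl L (Z - W) -> orth_proj L Z = W.
Proof.
move=> LB LW ZW; rewrite /orth_proj; case: xgetP => [U _ [LU ZU]|/(_ W)]; last first.
  by case; split.
apply/eqP; rewrite -subr_eq0; apply/eqP/frob_eq0.
have LUW := LB _ _ LU LW.
have -> : frob (U - W) (U - W) = frob (U - W) (Z - W) - frob (U - W) (Z - U).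
  rewrite /frob -raddfB /= -mulmxBl -raddfB /=; congr (\tr (_^T *m _)).
  by rewrite opprB [RHS]addrC subrKA.
by rewrite ZW// ZU// subrr.
Qed.

(* Main.v *)
(** Let [G] be the Moore-Penrose inverse of [X], [A = 1 - X G] and [B = 1 - G X],
    and let [P Z = A Z B]. Along a sequence of rank at most [r] approaching [X]
    with velocity [Z], rescaling the blocks gives matrices of rank at most [r]
    converging to [X + P Z], whose rank is [rank X + rank (P Z)]; since the rank
    is lower semicontinuous, [rank (P Z) <= r - rank X]. Conversely
    [(1 + t Z G) X (1 + t G Z B) + t P Z] is a curve of rank at most
    [rank X + rank (P Z)] with velocity [Z]. For [r = rank X] this identifies the
    tangent space of the fixed rank manifold with the kernel of [P]; as [P] is an
    orthogonal projection, the normal space is its range. *)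

Require Import Defs.
From mathcomp Require Import all_boot all_order all_algebra.
From mathcomp Require Import all_classical all_reals all_analysis.

Set Implicit Arguments.
Unset Strict Implicit.
Unset Printing Implicit Defensive.

Import Order.TTheory GRing.Theory Num.Theory.
Import numFieldNormedType.Exports.

Local Open Scope classical_set_scope.
Local Open Scope ring_scope.

(** * Moore-Penrose inverse *)

Lemma mx_gram_unit (R : realType) (k n : nat) (D : 'M[R]_(k, n)) :
  row_free D -> D *m D^T \in unitmx.
Proof.
move=> Dfree; rewrite -row_free_unit; apply: inj_row_free => v vDD.
(* The squared norm of [v *m D] is [v *m D *m D^T *m v^T], which vanishes. *)
suff vD : (v *m D)^T = 0.
  by apply: (row_free_inj Dfree); rewrite mul0mx -[LHS]trmxK vD trmx0.
by apply: frob_eq0; rewrite /frob trmxK trmx_mul mulmxA -(mulmxA v) vDD mul0mx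
  mxtrace0.
Qed.

Lemma frobBr (R : realType) (m n : nat) (V U W : 'M[R]_(m, n)) :
  frob V (U - W) = frob V U - frob V W.
Proof. by rewrite /frob linearB /= mulmxBl linearB. Qed.

Lemma moore_penrose_exists (R : realType) (m n : nat) (X : 'M[R]_(m, n)) :
  exists G : 'M[R]_(n, m), [/\ X *m G *m X = X, (X *m G)^T = X *m G
    & (G *m X)^T = G *m X].
Proof.
move: (mulmx_base X) (col_base_full X) (row_base_free X).
move: (\rank X) (col_base X) (row_base X) => k C D <- /eqP C_rank Dfree.
have CU : C^T *m C \in unitmx.
  by rewrite -{2}[C]trmxK; apply: mx_gram_unit; rewrite -row_leq_rank mxrank_tr C_rank.
have DU := mx_gram_unit Dfree.
(* Formula from the full-rank factorization [X = C *m D]: [X *m G] and [G *m X] become the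
   orthogonal projections onto the column space of [C] and the row space of [D]. *)
exists (D^T *m invmx (D *m D^T) *m invmx (C^T *m C) *m C^T).
set G := _ *m C^T.
have XG : C *m D *m G = C *m invmx (C^T *m C) *m C^T.
  by rewrite /G !mulmxA -(mulmxA C D) (mulmxK DU).
have GX : G *m (C *m D) = D^T *m invmx (D *m D^T) *m D.
  by rewrite /G !mulmxA -(mulmxA _ C^T C) -(mulmxA _ (invmx (C^T *m C))) mulVmx// mulmx1.
split.
- by rewrite XG !mulmxA -(mulmxA _ C^T C) -(mulmxA _ (invmx (C^T *m C))) mulVmx// mulmx1.
- by rewrite XG !trmx_mul trmx_inv !trmx_mul !trmxK mulmxA.
- by rewrite GX !trmx_mul trmx_inv !trmx_mul !trmxK mulmxA.
Qed.

(** * Limits of matrices and semicontinuity of the rank *)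

Section MatrixLimits.
Context {R : realType} {T : Type} {F : set_system T} {FF : Filter F}.

Lemma cvg_mxP (m n : nat) (f : T -> 'M[R]_(m, n)) (l : 'M[R]_(m, n)) :
  f @ F --> l <-> forall i j, (fun x => f x i j) @ F --> l i j.
Proof.
split=> [fl i j|fl].
  by apply: (cvg_comp f (fun M => M i j) fl); exact: coord_continuous.
apply/cvgrPdist_lt => e e0.
have : \forall x \near F, forall i j, `|l i j - f x i j| < e.
  apply: filter_forall => i; apply: filter_forall => j.
  by move/cvgrPdist_lt: (fl i j) => /(_ e e0).
apply: filterS => x lfx; rewrite /Num.norm /= mx_normrE.
by apply: bigmax_lt => //= ij _; rewrite !mxE.
Qed.

Lemma cvg_mulmx (m n p : nat) (f : T -> 'M[R]_(m, n)) (g : T -> 'M[R]_(n, p))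
    (a : 'M[R]_(m, n)) (b : 'M[R]_(n, p)) :
  f @ F --> a -> g @ F --> b -> (fun x => f x *m g x) @ F --> a *m b.
Proof.
move=> /cvg_mxP fa /cvg_mxP gb; apply/cvg_mxP => i j; rewrite mxE.
under eq_cvg do rewrite mxE.
apply: cvg_big => [|k _]; first exact: add_continuous.
by apply: cvgM; [exact: fa|exact: gb].
Qed.

Lemma cvg_det (n : nat) (f : T -> 'M[R]_n) (a : 'M[R]_n) :
  f @ F --> a -> (fun x => \det (f x)) @ F --> \det a.
Proof.
move=> /cvg_mxP fa; apply: cvg_big => [|s _]; first exact: add_continuous.
apply: cvgM; first exact: cvg_cst.
by apply: cvg_big => [|i _]; [exact: mul_continuous|exact: fa].
Qed.

Lemma cvg_addZ0 (m n : nat) (X : 'M[R]_(m, n)) (t : T -> R) (f : T -> 'M[R]_(m, n))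
    (a : 'M[R]_(m, n)) :
  t @ F --> (0 : R) -> f @ F --> a -> (fun x => X + t x *: f x) @ F --> X.
Proof.
by move=> t0 fa; have := cvgD (cvg_cst X) (cvgZ t0 fa); rewrite scale0r addr0; exact.
Qed.

(** One-sided inverses [P], [Q] of the rank factors of [a] compress [a] to the identity of size
    [\rank a]. The determinant of the compressed [f x] tends to 1, so it is eventually nonzero. *)
Lemma mxrank_lower_semicontinuous (m n : nat) (f : T -> 'M[R]_(m, n)) (a : 'M[R]_(m, n)) :
  f @ F --> a -> \forall x \near F, (\rank a <= \rank (f x))%N.
Proof.
move=> fa.
have [P Pa] := row_fullP (col_base_full a).
have [Q aQ] := row_freeP (row_base_free a).
have PaQ : P *m a *m Q = 1%:M.
  by rewrite -[X in P *m X](mulmx_base a) mulmxA Pa mul1mx aQ.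
have : (fun x => \det (P *m f x *m Q)) @ F --> \det (P *m a *m Q).
  by apply: cvg_det; do ![apply: cvg_mulmx => //; try exact: cvg_cst].
rewrite PaQ det1 => /cvgr_neq0 /(_ (oner_neq0 _)).
apply: filterS => x; rewrite -unitfE -[_ \is a _]/(_ \in unitmx) => /mxrank_unit <-.
exact: leq_trans (mxrankM_maxl _ _) (mxrankM_maxr _ _).
Qed.

End MatrixLimits.

(** * Tangent cones in terms of a generalized inverse *)

Section RankVarietyTangent.
Variables (R : realType) (m n : nat) (X : 'M[R]_(m, n)) (G : 'M[R]_(n, m)).
Hypothesis (XGX : X *m G *m X = X).

Local Notation A := (1%:M - X *m G).
Local Notation B := (1%:M - G *m X).

Lemma ginv_compll : A *m X = 0.
Proof. by rewrite mulmxBl mul1mx XGX subrr. Qed.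

Lemma ginv_complr : X *m B = 0.
Proof. by rewrite mulmxBr mulmx1 mulmxA XGX subrr. Qed.

Lemma ginv_compll_idem : A *m A = A.
Proof. by rewrite mulmxBr mulmx1 mulmxA ginv_compll mul0mx subr0. Qed.

Lemma ginv_complr_idem : B *m B = B.
Proof. by rewrite mulmxBl -mulmxA ginv_complr mulmx0 mul1mx subr0. Qed.

Lemma ginv_compl_mx_idem (Z : 'M[R]_(m, n)) : A *m (A *m Z *m B) *m B = A *m Z *m B.
Proof.
by rewrite -!mulmxA ginv_complr_idem !mulmxA ginv_compll_idem.
Qed.

(** The row spaces of [X] and [E] meet trivially, as [B] kills the first and fixes the second. That
    of the sum contains both, since [A *m (X + E) = E]. *)
Lemma mxrank_add_ginv_compl (Z : 'M[R]_(m, n)) :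
  \rank (X + A *m Z *m B)%R = (\rank X + \rank (A *m Z *m B))%N.
Proof.
set E := A *m Z *m B.
have AE : A *m E = E by rewrite /E !mulmxA ginv_compll_idem.
have EB : E *m B = E by rewrite /E -!mulmxA ginv_complr_idem.
apply/eqP; rewrite eqn_leq mxrank_add/=.
have XE0 : (X :&: E)%MS = 0.
  apply/eqP/rowV0P => v; rewrite sub_capmx => /andP[/submxP[u ->] /submxP[w uXwE]].
  by rewrite uXwE -EB mulmxA -uXwE -mulmxA ginv_complr mulmx0.
rewrite -(mxrank_disjoint_sum XE0) mxrankS// addsmx_sub; apply/andP.
have subE : (E <= (X + E)%R)%MS.
  by rewrite -{1}[E]add0r -{1}ginv_compll -{1}AE -mulmxDr submxMl.
split=> //; rewrite -{1}[X](addrK E).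
by rewrite addmx_sub// -scaleN1r scalemx_sub.
Qed.

(* Multiplying by [X G + t^(-1/2) A] on the left and [G X + t^(-1/2) B] on the
   right does not increase the rank; it scales the normal block by 1/t and the
   mixed blocks, which are O(t), only by t^(-1/2), so the limit is block diagonal. *)
Lemma tangent_cone_rank_le_sub (r : nat) (Z : 'M[R]_(m, n)) :
  tangent_cone (mx_rank_le R m n r) X Z -> (\rank (A *m Z *m B) <= r - \rank X)%N.
Proof.
move=> [x_ [t_ [xr xX t0 xZ]]].
pose c i := (Num.sqrt (t_ i))^-1.
have cc i : c i * c i = (t_ i)^-1.
  by rewrite /c -invfM -expr2 sqr_sqrtr// ltW.
(* As [t_] is not assumed to tend to 0, entries are squared: each square is an entry of [x_ i - X],
   tending to 0, times an entry of the convergent quotient. *)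
have cD : (fun i => c i *: (x_ i - X)) @ \oo --> (0 : 'M[R]_(m, n)).
  apply/cvg_mxP => i j.
  have xX0 : (fun k => x_ k - X) @ \oo --> (0 : 'M[R]_(m, n)).
    by rewrite -(subrr X); apply: cvgB => //; exact: cvg_cst.
  have sq0 : (fun k => (c k *: (x_ k - X)) i j ^+ 2) @ \oo --> (0 : R).
    have -> : (fun k => (c k *: (x_ k - X)) i j ^+ 2) =
       (fun k => (x_ k - X) i j * ((t_ k)^-1 *: (x_ k - X)) i j).
      by apply/funext => k; rewrite !mxE exprMn expr2 cc expr2 mulrCA mulrA.
    have -> : (0 : R) = (0 : 'M[R]_(m, n)) i j * Z i j by rewrite mxE mul0r.
    by apply: cvgM; move: i j; apply/cvg_mxP.
  rewrite mxE; apply: norm_cvg0.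
  have := cvg_comp _ _ sq0 (@sqrt_continuous R 0); rewrite sqrtr0.
  by under eq_cvg do rewrite /= sqrtr_sqr.
have blowup : (fun i => (X *m G + c i *: A) *m x_ i *m (G *m X + c i *: B)) @ \oo
    --> X + A *m Z *m B.
  have -> : (fun i => (X *m G + c i *: A) *m x_ i *m (G *m X + c i *: B)) =
    (fun i => X *m G *m x_ i *m (G *m X) + (X *m G *m (c i *: (x_ i - X)) *m B
      + A *m (c i *: (x_ i - X)) *m (G *m X)) + A *m ((t_ i)^-1 *: (x_ i - X)) *m B).
    apply/funext => i.
    have -> : A *m ((t_ i)^-1 *: (x_ i - X)) *m B = (t_ i)^-1 *: (A *m x_ i *m B).
      by rewrite -scalemxAr -scalemxAl (mulmxBr A) ginv_compll subr0.
    have -> : X *m G *m (c i *: (x_ i - X)) *m B = c i *: (X *m G *m x_ i *m B).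
      by rewrite -scalemxAr -scalemxAl (mulmxBr (X *m G)) XGX mulmxBl ginv_complr subr0.
    have -> : A *m (c i *: (x_ i - X)) *m (G *m X) = c i *: (A *m x_ i *m (G *m X)).
      by rewrite -scalemxAr -scalemxAl (mulmxBr A) ginv_compll subr0.
    (* Generalizing [A] and [B] keeps distributivity from expanding them. *)
    rewrite -cc -scalerA; move: A B => A' B'.
    rewrite !(mulmxDl, mulmxDr) -!scalemxAl -!scalemxAr !addrA.
    by congr (_ + _); exact: addrAC.
  have -> : X + A *m Z *m B = X *m G *m X *m (G *m X) + (X *m G *m 0 *m B
      + A *m 0 *m (G *m X)) + A *m Z *m B.
    by rewrite !mulmx0 !mul0mx !addr0 XGX mulmxA XGX.
  by do ![apply: cvgD | apply: cvg_mulmx => //; try exact: cvg_cst].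
have [i _ /(_ i (leqnn i))] := mxrank_lower_semicontinuous blowup.
rewrite mxrank_add_ginv_compl => le_rank.
rewrite -(addKn (\rank X) (\rank (_ *m B))) leq_sub2r// (leq_trans le_rank)//.
apply: leq_trans (mxrankM_maxl _ _) _; apply: leq_trans (mxrankM_maxr _ _) _.
exact: xr.
Qed.

(* The curve [(1 + t Z G) X (1 + t G Z B) + t A Z B] through [X] has velocity [Z]. *)
Lemma rank_curve (Z : 'M[R]_(m, n)) :
  exists W : 'M[R]_(m, n), forall t,
    (\rank (X + t *: (Z + t *: W))%R <= \rank X + \rank (A *m Z *m B))%N.
Proof.
(* The coefficient of [t ^+ 2] in the product of the curve. *)
exists (Z *m G *m X *m G *m Z *m B) => t.
have -> : X + t *: (Z + t *: (Z *m G *m X *m G *m Z *m B)) =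
    (1%:M + t *: (Z *m G)) *m X *m (1%:M + t *: (G *m Z *m B))
    + (t *: A *m Z *m B).
  have {1}-> : Z = Z *m G *m X + X *m G *m Z *m B + A *m Z *m B.
    rewrite -[A *m Z *m B]mulmxA mulmxBl mul1mx !mulmxA -addrA subrKC.
    by rewrite mulmxBr mulmx1 mulmxA subrKC.
  move: A B => A' B'; rewrite !(mulmxDl, mulmxDr) mul1mx !mulmx1 -!scalemxAl -!scalemxAr.
  rewrite !mulmxA !scalerDr !addrA.
  exact: addrAC.
apply: (leq_trans (mxrank_add _ _)); apply: leq_add.
  exact: leq_trans (mxrankM_maxl _ _) (mxrankM_maxr _ _).
by rewrite -!scalemxAl; exact/mxrankS/scalemx_sub.
Qed.

Lemma tangent_cone_curve (S : set 'M[R]_(m, n)) (Z W : 'M[R]_(m, n)) (t : nat -> R) :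
  (forall i, 0 < t i) -> t @ \oo --> (0 : R) ->
  (\forall i \near \oo, S (X + t i *: (Z + t i *: W))) ->
  tangent_cone S X Z.
Proof.
move=> t_gt0 t0 [N _ NS].
have ZW : (fun i => Z + t i *: W) @ \oo --> Z by apply: cvg_addZ0 => //; exact: cvg_cst.
(* The cone requires every term to lie in [S], hence the shift past [N]. *)
exists (fun i => X + t (i + N)%N *: (Z + t (i + N)%N *: W)), (fun i => t (i + N)%N).
split.
- by move=> i; apply: NS; rewrite /= leq_addl.
- rewrite (cvg_shiftn N (fun i => X + t i *: (Z + t i *: W))).
  exact: cvg_addZ0 ZW.
- by move=> i; exact: t_gt0.
- suff -> : (fun i => (t (i + N)%N)^-1 *: (X + t (i + N)%N *: (Z + t (i + N)%N *: W) - X)) =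
      (fun i => Z + t (i + N)%N *: W).
    by rewrite (cvg_shiftn N (fun i => Z + t i *: W)).
  apply/funext => i.
  by rewrite [X + _]addrC addrK scalerA mulVf ?gt_eqF// scale1r.
Qed.

Lemma tangent_cone_rank_leE (r : nat) : (\rank X <= r)%N ->
  tangent_cone (mx_rank_le R m n r) X
    = [set Z | (\rank (A *m Z *m B) <= r - \rank X)%N].
Proof.
move=> Xr; apply/seteqP; split=> Z; first exact: tangent_cone_rank_le_sub.
move=> /= AZB; have [W Wrank] := rank_curve Z.
apply: (@tangent_cone_curve _ _ W harmonic).
- by move=> i; rewrite invr_gt0.
- exact: cvg_harmonic.
- apply: nearW => i; apply: leq_trans (Wrank _) _.
  by rewrite -leq_subRL.
Qed.

Lemma tangent_cone_rank_eqE :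
  tangent_cone (mx_rank_eq R m n (\rank X)) X = [set Z | A *m Z *m B = 0].
Proof.
apply/seteqP; split=> Z.
  move=> [x_ [t_ [xr xX t0 xZ]]]; apply/eqP; rewrite -mxrank_eq0 -leqn0.
  rewrite -[leqRHS](subnn (\rank X)); apply: tangent_cone_rank_le_sub.
  by exists x_, t_; split=> // i; rewrite /mx_rank_le /= xr.
move=> /= AZB; have [W Wrank] := rank_curve Z.
have h0 : (@harmonic R) @ \oo --> (0 : R) by exact: cvg_harmonic.
apply: (@tangent_cone_curve _ _ W harmonic) => //.
  by move=> i; rewrite invr_gt0.
have ZW : (fun i => Z + @harmonic R i *: W) @ \oo --> Z.
  by apply: cvg_addZ0 => //; exact: cvg_cst.
have XZW : (fun i => X + @harmonic R i *: (Z + @harmonic R i *: W)) @ \oo --> X.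
  exact: cvg_addZ0 ZW.
(* The curve has rank at most [\rank X]; semicontinuity gives the reverse bound eventually. *)
have [N _ Xle] := mxrank_lower_semicontinuous XZW; exists N => // i /Xle /= {}Xle.
apply/eqP; rewrite eqn_leq Xle andbT.
by have := Wrank (harmonic i); rewrite AZB mxrank0 addn0.
Qed.

(** * Normal space and orthogonal projection *)

Hypotheses (XG_sym : (X *m G)^T = X *m G) (GX_sym : (G *m X)^T = G *m X).

(** Symmetry of [A] and [B] and cyclicity of the trace make the compression self-adjoint. *)
Lemma frob_ginv_compl (V W : 'M[R]_(m, n)) :
  frob V (A *m W *m B) = frob (A *m V *m B) W.
Proof.
have AT : A^T = A by rewrite linearB /= trmx1 XG_sym.
have BT : B^T = B by rewrite linearB /= trmx1 GX_sym.
rewrite /frob !trmx_mul AT BT.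
by rewrite -!mulmxA [LHS]mxtrace_mulC !mulmxA.
Qed.

Lemma mx_normal_space_rank_eqE :
  mx_normal_space (mx_rank_eq R m n (\rank X)) X = [set W | A *m W *m B = W].
Proof.
rewrite /mx_normal_space tangent_cone_rank_eqE; apply/seteqP; split=> W /=; last first.
  by move=> <- V /= V0; rewrite frob_ginv_compl V0 /frob mulmx0 mxtrace0.
move=> Worth; apply/esym/eqP; rewrite -subr_eq0; apply/eqP/frob_eq0.
(* The difference is tangent, hence orthogonal to [W]; by self-adjointness it is also orthogonal to
   [A *m W *m B], so to itself. *)
have AVB0 : A *m (W - A *m W *m B) *m B = 0.
  by rewrite (mulmxBr A) (mulmxBl _ _ B) ginv_compl_mx_idem subrr.
by rewrite frobBr Worth// frob_ginv_compl AVB0 /frob mulmx0 mxtrace0 subr0.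
Qed.

Lemma orth_proj_normal_spaceE (Z : 'M[R]_(m, n)) :
  orth_proj (mx_normal_space (mx_rank_eq R m n (\rank X)) X) Z = A *m Z *m B.
Proof.
rewrite mx_normal_space_rank_eqE; apply: orth_projE => [U V /= UE VE||V /= VE].
- by rewrite (mulmxBr A) (mulmxBl _ _ B) UE VE.
- exact: ginv_compl_mx_idem.
- by rewrite frobBr frob_ginv_compl VE subrr.
Qed.

End RankVarietyTangent.

Theorem theorem4p1 (R : realType) (m n r : nat) (hr : (r < minn m n)%N)
    (X : 'M[R]_(m, n)) (hX : mx_rank_le R m n r X) :
  let r_ := \rank X in
  let T : set 'M[R]_(m, n) := tangent_cone (mx_rank_eq R m n r_) X in
  let N : set 'M[R]_(m, n) := mx_normal_space (mx_rank_eq R m n r_) X in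
  [/\ tangent_cone (mx_rank_le R m n r) X
        = [set U + V | U in T & V in N `&` mx_rank_le R m n (r - r_)],
      [set U + V | U in T & V in N `&` mx_rank_le R m n (r - r_)]
        = [set U + V | U in T & V in mx_rank_le R m n (r - r_)]
    & [set U + V | U in T & V in mx_rank_le R m n (r - r_)]
        = [set Z | (\rank (orth_proj N Z) <= r - r_)%N]].
Proof.
move=> r_ T N.
have [G [XGX XG_sym GX_sym]] := moore_penrose_exists X.
pose P Z := (1%:M - X *m G) *m Z *m (1%:M - G *m X).
have PD U V : P (U + V) = P U + P V by rewrite /P (mulmxDr (_ - _)) (mulmxDl _ _ (_ - _)).
have rankP Z : (\rank (P Z) <= \rank Z)%N.
  exact: leq_trans (mxrankM_maxl _ _) (mxrankM_maxr _ _).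
have TE : T = [set Z | P Z = 0] by exact: tangent_cone_rank_eqE.
have NE : N = [set Z | P Z = Z] by exact: mx_normal_space_rank_eqE.
have projE Z : orth_proj N Z = P Z by exact: orth_proj_normal_spaceE.
have TsubP Z : T (Z - P Z).
  by rewrite TE /= /P (mulmxBr (_ - _)) (mulmxBl _ _ (_ - _)) ginv_compl_mx_idem// subrr.
(* Both Minkowski sums equal [C]: [P] kills the tangent summand and does not raise the rank of the
   other, while [Z = (Z - P Z) + P Z] splits [Z] into a tangent and a normal part. *)
pose C := [set Z | (\rank (P Z) <= r - r_)%N].
have sumC : [set U + V | U in T & V in mx_rank_le R m n (r - r_)] = C.
  apply/seteqP; split=> [_ [U TU [V rV <-]]|Z CZ].
    move: TU; rewrite TE /C /= PD => ->; rewrite add0r.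
    exact: leq_trans (rankP V) rV.
  by exists (Z - P Z) => //; exists (P Z) => //; exact: subrK.
have sumN : [set U + V | U in T & V in N `&` mx_rank_le R m n (r - r_)] = C.
  apply/seteqP; split=> [|Z CZ].
    by rewrite -sumC => _ [U TU [V [_ rV] <-]]; exists U => //; exists V.
  exists (Z - P Z) => //.
  by exists (P Z); [split=> //; rewrite NE; exact: ginv_compl_mx_idem | exact: subrK].
rewrite sumN sumC; split=> //.
  exact: tangent_cone_rank_leE.
by apply/funext => Z; rewrite /C /= projE.
Qed.
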